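(* Let $V$ be a countable directed tree (with or without root) and let $B_\lambda$ be a continuous weighted backward shift defined on the weighted real space $\ell^1(V,\mu)$, where $\mu=(\mu_v)_{v\in V}$ and $\lambda=(\lambda_v)_{v\in V\setminus\{\mathrm{root}\}}$ are sequences of non-zero real weights. Then there exist a metric space $M_V$ (with a distinguished point $0$) and a Lipschitz map $f\in\mathrm{Lip}_0(M_V,M_V)$ such that the dynamical system $(\ell^1(V,\mu),B_\lambda)$ is topologically conjugate to $(\mathcal F(M_V),T_f)$ through an isometric isomorphism, i.e. there is a surjective linear isometry $\Phi\colon\ell^1(V,\mu)\to\mathcal F(M_V)$ with $\Phi\circ B_\lambda=T_f\circ\Phi$.
   Context: A countable directed tree is a pair $(V,E)$ with $V$ a countable vertex set and $E\subset V\times V\setminus\{(v,v):v\in V\}$ a set of directed edges such that the graph is connected, has no cycles, and for every $v\in V$ there is at most one $w\in V$ with $(w,v)\in E$; this $w$ is the parent of $v$, $w=\mathrm{par}(v)$, and $v$ is a child of $w$, $v\in\mathrm{Chi}(w)$. There is at most one vertex without a parent; if it exists it is called the root (if there is no root, $V\setminus\{\mathrm{root}\}$ means $V$). $\ell^1(V,\mu)=\{x\in\mathbb R^V:\|x\|_1:=\sum_{v\in V}|x(v)\mu_v|<\infty\}$. The weighted backward shift is defined by $(B_\lambda x)(v)=\sum_{u\in\mathrm{Chi}(v)}\lambda_u x(u)$, $v\in V$. For a metric space $(M,d)$ with distinguished point $0$, $\mathrm{Lip}_0(M)$ is the real Banach space of Lipschitz functions $g\colon M\to\mathbb R$ with $g(0)=0$,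 normed by the Lipschitz constant; $\delta_x\in\mathrm{Lip}_0(M)^*$ is evaluation at $x$; the Lipschitz-free space is $\mathcal F(M)=\overline{\operatorname{span}}\{\delta_x:x\in M\}\subset\mathrm{Lip}_0(M)^*$. $\mathrm{Lip}_0(M,M)$ is the set of Lipschitz maps $f\colon M\to M$ with $f(0)=0$, and $T_f\colon\mathcal F(M)\to\mathcal F(M)$ is the unique bounded linear operator with $T_f(\delta_x)=\delta_{f(x)}$ for all $x\in M$. *)

(* Defs.v *)
From HB Require Import structures.
From mathcomp Require Import all_boot all_order all_algebra.
From mathcomp Require Import all_classical all_reals all_analysis.

Set Implicit Arguments.
Unset Strict Implicit.
Unset Printing Implicit Defensive.

Import Order.TTheory GRing.Theory Num.Theory.
Import numFieldNormedType.Exports.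

Local Open Scope classical_set_scope.
Local Open Scope ring_scope.

Section DirectedTree.
Context (V : countType) (E : rel V).

(* [E w v] is the edge from the parent [w] to its child [v]. Connectedness
   refers to the underlying undirected graph. Cycles are directed, of any
   length; since a vertex has at most one parent, every cycle of the underlying
   undirected graph is a directed one. *)
Record directed_tree : Prop := DirectedTree {
  edge_irrefl : irreflexive E;
  edge_connected : forall u v, exists2 p,
    path (fun x y => E x y || E y x) u p & last u p = v;
  edge_acyclic : forall c, cycle E c -> uniq c -> c = [::];
  parent_unique : forall v w w', E w v -> E w' v -> w = w'
}.

Definition is_root (v : V) : Prop := forall w, ~~ E w v.

Definition chi (v : V) : set V := [set u | E v u].

End DirectedTree.

Section WeightedEll1.
Context (R : realType) (V : countType).

Lemma esumZl (D : set V) (a : R) (f : V -> \bar R) : 0 <= a ->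
  (forall v, 0 <= f v)%E ->
  (\esum_(v in D) (a%:E * f v) = a%:E * \esum_(v in D) f v)%E.
Proof.
move=> a0 f0.
have le_esumZ (b : R) (g : V -> \bar R) : 0 <= b -> (forall v, 0 <= g v)%E ->
    (\esum_(v in D) (b%:E * g v) <= b%:E * \esum_(v in D) g v)%E.
  move=> b0 g0; apply: ge_ereal_sup => _ [A AD <-].
  rewrite -ge0_mule_fsumr//; apply: lee_wpmul2l; first by rewrite lee_fin.
  by apply: ereal_sup_ubound; exists A.
apply/eqP; rewrite eq_le le_esumZ//=.
have [->|an0] := eqVneq a 0.
  by rewrite mul0e esum_ge0// => v _; rewrite mul0e.
have ai0 : 0 <= a^-1 by rewrite invr_ge0.
have := le_esumZ a^-1 (fun v => a%:E * f v)%E ai0.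
rewrite [X in (X <= _)%E](_ : _ = \esum_(v in D) f v)%E; last first.
  by apply: eq_esum => v _; rewrite muleA -EFinM mulVf// mul1e.
move=> H; rewrite -[leRHS]mul1e -(divff an0) EFinM -muleA.
apply: lee_wpmul2l; rewrite ?lee_fin//; apply: H => v.
by rewrite mule_ge0// lee_fin.
Qed.

Definition ell1_pred (mu : V -> R) : {pred (V -> R)} :=
  mem [set x : V -> R | summable [set: V] (fun v => (x v * mu v)%:E)].

Fact ell1_submod_closed mu : submod_closed (ell1_pred mu).
Proof.
split=> [|a x y].
  rewrite inE /= /summable esum1 ?ltry// => v _.
  by rewrite mul0r /= normr0.
rewrite !inE /= => xs ys.
have axs : summable [set: V] (fun v => (a * (x v * mu v))%:E).
  rewrite /summable (_ : esum _ _ =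
      `|a|%:E * \esum_(v in [set: V]) `|(x v * mu v)%:E|)%E; last first.
    rewrite -esumZl//; apply: eq_esum => v _.
    by rewrite /= normrM EFinM.
  by move: xs; rewrite summableE => /fineK <-; rewrite -EFinM ltry.
apply: le_lt_trans (summableD axs ys); apply: le_esum => v _.
by rewrite /= mulrDl -mulrA.
Qed.

HB.instance Definition _ mu :=
  GRing.isSubmodClosed.Build _ _ (ell1_pred mu) (ell1_submod_closed mu).

Record ell1 (mu : V -> R) (mu0 : forall v, mu v != 0) := Ell1 {
  ell1_fun :> V -> R;
  ell1_funP : ell1_fun \in ell1_pred mu
}.

Section Ell1Norm.
Context (mu : V -> R) (mu0 : forall v, mu v != 0).

HB.instance Definition _ := [isSub for @ell1_fun mu mu0].
HB.instance Definition _ := [Choice of ell1 mu0 by <:].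
HB.instance Definition _ := [SubChoice_isSubLmodule of ell1 mu0 by <:].

Definition ell1_norm (x : ell1 mu0) : R :=
  fine (\esum_(v in [set: V]) `|(x v * mu v)%:E|)%E.

Let ell1_normE (x : ell1 mu0) :
  (ell1_norm x)%:E = (\esum_(v in [set: V]) `|(x v * mu v)%:E|)%E.
Proof.
by rewrite /ell1_norm fineK// -summableE; have := ell1_funP x; rewrite inE.
Qed.

Fact ell1_normD x y : ell1_norm (x + y) <= ell1_norm x + ell1_norm y.
Proof.
rewrite -lee_fin EFinD !ell1_normE -esumD//; apply: le_esum => v _.
by rewrite /= -EFinD lee_fin mulrDl ler_normD.
Qed.

Fact ell1_normZ a x : ell1_norm (a *: x) = `|a| * ell1_norm x.
Proof.
apply: EFin_inj; rewrite EFinM !ell1_normE -esumZl//.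
by apply: eq_esum => v _; rewrite /= -mulrA normrM EFinM.
Qed.

Fact ell1_norm0_eq0 x : ell1_norm x = 0 -> x = 0.
Proof.
move=> x0; apply/val_inj/funext => v /=.
have : (`|(x v * mu v)%:E| <= 0)%E.
  have -> : 0%E = (ell1_norm x)%:E by rewrite x0.
  rewrite ell1_normE -[leLHS](@esum_set1 R V v (fun v => `|(x v * mu v)%:E|%E))//.
  apply: ge_ereal_sup => _ [A [Af _] <-].
  by apply: ereal_sup_ubound; exists A.
rewrite lee_fin normr_le0 mulf_eq0 (negPf (mu0 v)) orbF => /eqP -> //.
Qed.

HB.instance Definition _ := Lmodule_isNormed.Build R (ell1 mu0)
  ell1_normD ell1_normZ ell1_norm0_eq0.

(* Sum over [D] of an absolutely summable family of reals. *)
Definition rsum (D : set V) (a : V -> R) : R :=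
  fine (\esum_(u in D) (EFin \o a)^\+ u)%E -
  fine (\esum_(u in D) (EFin \o a)^\- u)%E.

(* [B] is the weighted backward shift on [ell1 mu0]: for each [x] and [v] the
   series defining [(B_lambda x)(v)] converges absolutely (equivalently,
   unconditionally) and its sum is the value at [v] of an element of the space,
   namely [B x]. The value of [lambda] at a root is never used. *)
Definition is_backward_shift (E : rel V) (lambda : V -> R)
    (B : ell1 mu0 -> ell1 mu0) : Prop :=
  forall (x : ell1 mu0) (v : V),
    summable (chi E v) (fun u => (lambda u * x u)%:E) /\
    B x v = rsum (chi E v) (fun u => lambda u * x u).

End Ell1Norm.
End WeightedEll1.

Lemma linear_le_continuous (R : realType) (X Y : normedModType R)
    (f : X -> Y) (C : R) :
  linear f -> (forall x, `|f x| <= C * `|x|) -> continuous f.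
Proof.
move=> fl fC.
pose F : {linear X -> Y} := HB.pack f (GRing.isLinear.Build _ _ _ _ _ fl).
apply: (@bounded_linear_continuous _ _ _ F).
apply/linear_boundedP; near=> r => x; apply: le_trans (fC x) _.
by rewrite ler_wpM2r//; near: r; exact: nbhs_pinfty_ge.
Unshelve. all: by end_near. Qed.

Section Dual.
Context (R : realType) (X : normedModType R).

Definition dual_pred : {pred (X -> R)} :=
  mem [set phi : X -> R | linear phi /\ continuous phi].

Fact dual_submod_closed : submod_closed dual_pred.
Proof.
split=> [|a phi psi].
  by rewrite inE; split=> [b x y /=|]; [rewrite scaler0 addr0|exact: cst_continuous].
rewrite !inE => -[phil phic] [psil psic]; split=> [b x y|x].
  have E z : (a *: phi + psi) z = a * phi z + psi z by [].
  rewrite !E phil psil /GRing.scale/= !mulrDr addrACA.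
  by congr (_ + _ + _); rewrite mulrCA.
by apply: cvgD; [apply: cvgZr; exact: phic|exact: psic].
Qed.

HB.instance Definition _ :=
  GRing.isSubmodClosed.Build _ _ dual_pred dual_submod_closed.

Record topdual := Dual {
  dual_fun :> X -> R;
  dual_funP : dual_fun \in dual_pred
}.

HB.instance Definition _ := [isSub for dual_fun].
HB.instance Definition _ := [Choice of topdual by <:].
HB.instance Definition _ := [SubChoice_isSubLmodule of topdual by <:].

Lemma dual_linear (phi : topdual) : linear phi.
Proof. by have := dual_funP phi; rewrite inE => -[]. Qed.

Lemma dual_continuous (phi : topdual) : continuous phi.
Proof. by have := dual_funP phi; rewrite inE => -[]. Qed.

Definition opnorm (phi : topdual) : R :=
  sup [set `|phi x| | x in [set x : X | `|x| <= 1]].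

Let dualZ (phi : topdual) a x : phi (a *: x) = a * phi x.
Proof.
have phil := dual_linear phi.
have phi0 : phi 0 = 0.
  by have := phil 1 0 0; rewrite scale1r addr0 scale1r => /eqP;
     rewrite -subr_eq subrr => /eqP.
by rewrite -[a *: x]addr0 phil phi0 addr0.
Qed.

Lemma dual_bounded (phi : topdual) :
  exists2 r, 0 < r & forall x, `|phi x| <= r * `|x|.
Proof.
pose f : {linear X -> R} :=
  HB.pack (dual_fun phi) (GRing.isLinear.Build _ _ _ _ _ (dual_linear phi)).
have fc : continuous f by exact: dual_continuous.
by have /linear_bounded_continuous/linear_boundedP/pinfty_ex_gt0 := fc.
Qed.

Let opnorm_has_sup (phi : topdual) :
  has_sup [set `|phi x| | x in [set x : X | `|x| <= 1]].
Proof.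
split; first by exists `|phi 0|; exists 0 => //=; rewrite normr0.
have [r r0 phir] := dual_bounded phi.
exists r => _ [x /= x1 <-]; apply: le_trans (phir x) _.
by rewrite -[leRHS]mulr1 ler_wpM2l// ltW.
Qed.

Lemma opnorm_ge0 (phi : topdual) : 0 <= opnorm phi.
Proof.
apply: le_trans (normr_ge0 (phi 0)) _; apply: ub_le_sup.
  by have [] := opnorm_has_sup phi.
by exists 0 => //=; rewrite normr0.
Qed.

Lemma ler_opnorm (phi : topdual) x : `|phi x| <= opnorm phi * `|x|.
Proof.
have [->|x0] := eqVneq x 0.
  by rewrite -(scale0r 0) dualZ mul0r normr0 mulr_ge0// opnorm_ge0.
have nx0 : 0 < `|x| by rewrite normr_gt0.
rewrite -ler_pdivrMr//.
have -> : `|phi x| / `|x| = `|phi (`|x|^-1 *: x)|.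
  by rewrite dualZ normrM normfV normr_id mulrC.
apply: ub_le_sup; first by have [] := opnorm_has_sup phi.
by exists (`|x|^-1 *: x) => //=; rewrite normrZ normfV normr_id mulVf// gt_eqF.
Qed.

Lemma opnorm_le (phi : topdual) C : 0 <= C ->
  (forall x, `|phi x| <= C * `|x|) -> opnorm phi <= C.
Proof.
move=> C0 phiC; apply: ge_sup; first by have [] := opnorm_has_sup phi.
move=> _ [x /= x1 <-]; apply: le_trans (phiC x) _.
by rewrite -[leRHS]mulr1 ler_wpM2l.
Qed.

Fact opnormD phi psi : opnorm (phi + psi) <= opnorm phi + opnorm psi.
Proof.
apply: opnorm_le => [|x]; first by rewrite addr_ge0// opnorm_ge0.
by rewrite mulrDl (le_trans (ler_normD _ _))// lerD// ler_opnorm.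
Qed.

Fact opnormZ a phi : opnorm (a *: phi) = `|a| * opnorm phi.
Proof.
have leZ b psi : opnorm (b *: psi) <= `|b| * opnorm psi.
  apply: opnorm_le => [|x]; first by rewrite mulr_ge0// opnorm_ge0.
  by rewrite normrM -mulrA ler_wpM2l// ler_opnorm.
apply/eqP; rewrite eq_le leZ/=.
have [->|a0] := eqVneq a 0; first by rewrite normr0 mul0r opnorm_ge0.
rewrite -ler_pdivlMl ?normr_gt0// -normfV.
by rewrite -[X in opnorm X <= _](scalerK a0) leZ.
Qed.

Fact opnorm0_eq0 phi : opnorm phi = 0 -> phi = 0.
Proof.
move=> phi0; apply/val_inj/funext => x /=; apply/eqP.
by rewrite -normr_le0 (le_trans (ler_opnorm _ _))// phi0 mul0r.
Qed.

HB.instance Definition _ :=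
  Lmodule_isNormed.Build R topdual opnormD opnormZ opnorm0_eq0.

End Dual.

Section LipschitzFree.
Context (R : realType) (M : metricType R) (o : M).

Definition lip_pred : {pred (M -> R)} :=
  mem [set g : M -> R | g o = 0 /\
    exists k, forall x y, `|g x - g y| <= k * mdist x y].

Fact lip_submod_closed : submod_closed lip_pred.
Proof.
split=> [|a g h].
  rewrite inE; split=> //; exists 0 => x y.
  by rewrite subrr normr0 mul0r.
rewrite !inE => -[go [k gk]] [ho [l hl]]; split.
  have -> : (a *: g + h) o = a * g o + h o by [].
  by rewrite go ho addr0 mulr0.
exists (`|a| * k + l) => x y.
rewrite [X in `|X|](_ : _ = a * (g x - g y) + (h x - h y)); last first.
  have E z : (a *: g + h) z = a * g z + h z by [].
  by rewrite !E mulrBr opprD addrACA.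
rewrite (le_trans (ler_normD _ _))// mulrDl lerD// normrM -mulrA.
by rewrite ler_wpM2l.
Qed.

HB.instance Definition _ :=
  GRing.isSubmodClosed.Build _ _ lip_pred lip_submod_closed.

(* Lip_0(M), with base point [o] *)
Record lip0 := Lip0 {
  lip0_fun :> M -> R;
  lip0_funP : lip0_fun \in lip_pred
}.

HB.instance Definition _ := [isSub for lip0_fun].
HB.instance Definition _ := [Choice of lip0 by <:].
HB.instance Definition _ := [SubChoice_isSubLmodule of lip0 by <:].

(* The pairs with [p.1 = p.2] contribute the slope [0 / 0 = 0]. *)
Definition lip_const (g : lip0) : R :=
  sup [set `|g p.1 - g p.2| / mdist p.1 p.2 | p in [set: M * M]].

Lemma lip0_base (g : lip0) : g o = 0.
Proof. by have := lip0_funP g; rewrite inE => -[]. Qed.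

Let lip_has_sup (g : lip0) :
  has_sup [set `|g p.1 - g p.2| / mdist p.1 p.2 | p in [set: M * M]].
Proof.
split; first by eexists; exists (o, o).
have := lip0_funP g; rewrite inE => -[_ [k gk]].
exists `|k| => _ [[x y] _ <-] /=.
have [->|xy] := eqVneq x y; first by rewrite subrr normr0 mul0r.
rewrite ler_pdivrMr ?mdist_gt0// (le_trans (gk x y))//.
by rewrite ler_wpM2r ?mdist_ge0// ler_norm.
Qed.

Lemma lip_const_ge0 (g : lip0) : 0 <= lip_const g.
Proof.
apply: ub_le_sup; first by have [] := lip_has_sup g.
by exists (o, o) => //=; rewrite subrr normr0 mul0r.
Qed.

Lemma ler_lip_const (g : lip0) x y :
  `|g x - g y| <= lip_const g * mdist x y.
Proof.
have [->|xy] := eqVneq x y; first by rewrite subrr normr0 mdistxx mulr0.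
rewrite -ler_pdivrMr ?mdist_gt0//; apply: ub_le_sup.
  by have [] := lip_has_sup g.
by exists (x, y).
Qed.

Lemma lip_const_le (g : lip0) k : 0 <= k ->
  (forall x y, `|g x - g y| <= k * mdist x y) -> lip_const g <= k.
Proof.
move=> k0 gk; apply: ge_sup; first by have [] := lip_has_sup g.
move=> _ [[x y] _ <-] /=.
have [->|xy] := eqVneq x y; first by rewrite subrr normr0 mul0r.
by rewrite ler_pdivrMr ?mdist_gt0.
Qed.

Fact lip_constD g h : lip_const (g + h) <= lip_const g + lip_const h.
Proof.
apply: lip_const_le => [|x y]; first by rewrite addr_ge0// lip_const_ge0.
have E z : (g + h) z = g z + h z by [].
rewrite !E opprD addrACA mulrDl.
by rewrite (le_trans (ler_normD _ _))// lerD// ler_lip_const.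
Qed.

Fact lip_constZ a g : lip_const (a *: g) = `|a| * lip_const g.
Proof.
have leZ b h : lip_const (b *: h) <= `|b| * lip_const h.
  apply: lip_const_le => [|x y]; first by rewrite mulr_ge0// lip_const_ge0.
  by rewrite -mulrBr normrM -mulrA ler_wpM2l// ler_lip_const.
apply/eqP; rewrite eq_le leZ/=.
have [->|a0] := eqVneq a 0; first by rewrite normr0 mul0r lip_const_ge0.
rewrite -ler_pdivlMl ?normr_gt0// -normfV.
by rewrite -[X in lip_const X <= _](scalerK a0) leZ.
Qed.

Fact lip_const0_eq0 g : lip_const g = 0 -> g = 0.
Proof.
move=> g0; apply/val_inj/funext => x /=; apply/eqP.
rewrite -normr_le0; have := ler_lip_const g x o.
by rewrite lip0_base subr0 g0 mul0r.
Qed.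

HB.instance Definition _ :=
  Lmodule_isNormed.Build R lip0 lip_constD lip_constZ lip_const0_eq0.

Fact delta_subproof (x : M) : (fun g : lip0 => g x) \in @dual_pred R lip0.
Proof.
rewrite inE; split=> //.
apply: (@linear_le_continuous _ _ _ _ (mdist x o)) => // g.
by have := ler_lip_const g x o; rewrite lip0_base subr0 mulrC.
Qed.

Definition delta (x : M) : topdual lip0 := Dual (delta_subproof x).

Definition delta_span : set (topdual lip0) :=
  [set phi | exists n (a : 'I_n -> R) (x : 'I_n -> M),
    phi = \sum_(i < n) a i *: delta (x i)].

Definition free_pred : {pred (topdual lip0)} := mem (closure delta_span).

Lemma delta_spanP a phi psi : delta_span phi -> delta_span psi ->
  delta_span (a *: phi + psi).
Proof.
move=> [n [b [x ->]]] [m [c [y ->]]].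
exists (n + m)%N,
  (fun i : 'I_(n + m) => match fintype.split i with inl j => a * b j | inr j => c j end),
  (fun i : 'I_(n + m) => match fintype.split i with inl j => x j | inr j => y j end).
rewrite big_split_ord /= scaler_sumr; congr (_ + _); apply: eq_bigr => i _.
  by rewrite (unsplitK (inl i)) scalerA.
by rewrite (unsplitK (inr i)).
Qed.

Lemma delta_span_delta x : delta_span (delta x).
Proof.
by exists 1%N, (fun=> 1), (fun=> x); rewrite big_ord_recl big_ord0 addr0 scale1r.
Qed.

Lemma in_freeP (phi : topdual lip0) : reflect
  (forall e, 0 < e -> exists2 psi, delta_span psi & `|phi - psi| < e)
  (phi \in free_pred).
Proof.
apply: (iffP idP) => [|phiP].
  rewrite inE => phic e e0.
  have [psi [? ?]] := phic _ (nbhsx_ballx phi e e0).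
  by exists psi => //; rewrite -ball_normE.
rewrite inE => A /nbhs_ballP[e /= e0 eA].
have [psi ? ?] := phiP _ e0; exists psi; split=> //.
by apply: eA; rewrite -ball_normE.
Qed.

Fact free_submod_closed : submod_closed free_pred.
Proof.
split=> [|a phi psi /in_freeP phiP /in_freeP psiP].
  apply/in_freeP => e e0; exists 0; last by rewrite subrr normr0.
  exists 0%N, (fun=> 0), (fun=> o); by rewrite big_ord0.
apply/in_freeP => e e0.
have a1 : 0 < `|a| + 1 by rewrite ltr_wpDl.
have e2 : 0 < e / 2 by rewrite divr_gt0.
have [phi' phi's phi'e] := phiP (e / 2 / (`|a| + 1)) (divr_gt0 e2 a1).
have [psi' psi's psi'e] := psiP (e / 2) e2.
exists (a *: phi' + psi'); first exact: delta_spanP.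
rewrite opprD addrACA -scalerBr (le_lt_trans (ler_normD _ _))//.
rewrite [ltRHS]splitr ler_ltD// normrZ.
rewrite ltr_pdivlMr// in phi'e.
by rewrite (le_trans _ (ltW phi'e))// mulrC ler_wpM2l// lerDl.
Qed.

HB.instance Definition _ :=
  GRing.isSubmodClosed.Build _ _ free_pred free_submod_closed.

(* The Lipschitz-free space F(M), a closed subspace of the dual of Lip_0(M) *)
Record lip_free := Free {
  free_fun :> topdual lip0;
  free_funP : free_fun \in free_pred
}.

HB.instance Definition _ := [isSub for free_fun].
HB.instance Definition _ := [Choice of lip_free by <:].
HB.instance Definition _ := [SubChoice_isSubLmodule of lip_free by <:].

Definition free_norm (phi : lip_free) : R := `|val phi|.

Fact free_normD phi psi : free_norm (phi + psi) <= free_norm phi + free_norm psi.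
Proof. exact: ler_normD. Qed.

Fact free_normZ a phi : free_norm (a *: phi) = `|a| * free_norm phi.
Proof. exact: normrZ. Qed.

Fact free_norm0_eq0 phi : free_norm phi = 0 -> phi = 0.
Proof. by move=> /normr0_eq0 phi0; exact/val_inj. Qed.

HB.instance Definition _ :=
  Lmodule_isNormed.Build R lip_free free_normD free_normZ free_norm0_eq0.

Fact fdelta_subproof x : delta x \in free_pred.
Proof.
apply/in_freeP => e e0; exists (delta x); last by rewrite subrr normr0.
exact: delta_span_delta.
Qed.

Definition fdelta (x : M) : lip_free := Free (fdelta_subproof x).

(* [f] belongs to Lip_0(M, M) *)
Definition lip_self (f : M -> M) : Prop :=
  f o = o /\ exists k, forall x y, mdist (f x) (f y) <= k * mdist x y.

Definition is_linearization (f : M -> M) (T : lip_free -> lip_free) : Prop :=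
  [/\ linear T, continuous T & forall x, T (fdelta x) = fdelta (f x)].

(* The operator T_f; see [linearizationP] and [linearization_unique] for its
   existence and uniqueness when [f] is in Lip_0(M, M). *)
Definition linearization (f : M -> M) : lip_free -> lip_free :=
  xget (fun=> 0) [set T | is_linearization f T].

Section Linearization.
Context (f : M -> M) (fL : lip_self f).

Let f_bounded : exists2 k, 0 <= k &
  forall x y, mdist (f x) (f y) <= k * mdist x y.
Proof.
have [_ [k fk]] := fL; exists `|k| => // x y.
by rewrite (le_trans (fk x y))// ler_wpM2r ?mdist_ge0 ?ler_norm.
Qed.

Let pull_subproof (g : lip0) : (g \o f) \in lip_pred.
Proof.
have [k k0 fk] := f_bounded.
rewrite inE; split=> [|]; first by rewrite /= (proj1 fL) lip0_base.
exists (lip_const g * k) => x y.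
rewrite (le_trans (ler_lip_const _ _ _))// -mulrA ler_wpM2l//.
exact: lip_const_ge0.
Qed.

Let pull (g : lip0) : lip0 := Lip0 (pull_subproof g).

Let pull_linear a g h : pull (a *: g + h) = a *: pull g + pull h.
Proof. exact/val_inj. Qed.

Let pull_bounded : exists2 k, 0 <= k & forall g, `|pull g| <= k * `|g|.
Proof.
have [k k0 fk] := f_bounded; exists k => // g.
apply: lip_const_le => [|x y]; first by rewrite mulr_ge0// normr_ge0.
rewrite (le_trans (ler_lip_const g (f x) (f y)))// [X in _ <= X * _]mulrC -mulrA.
by rewrite ler_wpM2l// lip_const_ge0.
Qed.

Let adj_subproof (phi : topdual lip0) : (phi \o pull) \in @dual_pred R lip0.
Proof.
rewrite inE; have phil : linear (phi \o pull).
  by move=> a g h; rewrite /= pull_linear dual_linear.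
split=> //; have [k k0 pk] := pull_bounded.
apply: (@linear_le_continuous _ _ _ _ (`|phi| * k)) => // g /=.
rewrite (le_trans (ler_opnorm phi (pull g)))// -mulrA.
by apply: ler_wpM2l; [exact: opnorm_ge0|exact: pk].
Qed.

Let adj (phi : topdual lip0) : topdual lip0 := Dual (adj_subproof phi).

Let adj_linear : linear adj.
Proof. by move=> a phi psi; exact/val_inj. Qed.

Let adj_bounded : exists2 k, 0 <= k & forall phi, `|adj phi| <= k * `|phi|.
Proof.
have [k k0 pk] := pull_bounded; exists k => // phi.
apply: opnorm_le => [|g]; first by rewrite mulr_ge0// normr_ge0.
rewrite (le_trans (ler_opnorm phi (pull g)))// [X in _ <= X * _]mulrC -mulrA.
by apply: ler_wpM2l; [exact: opnorm_ge0|exact: pk].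
Qed.

Let adj_delta x : adj (delta x) = delta (f x).
Proof. exact/val_inj. Qed.

Let adj_span phi : delta_span phi -> delta_span (adj phi).
Proof.
pose F : {linear topdual lip0 -> topdual lip0} :=
  HB.pack adj (GRing.isLinear.Build _ _ _ _ _ adj_linear).
move=> [n [a [x ->]]]; exists n, a, (f \o x).
rewrite -[adj]/(F : _ -> _) linear_sum; apply: eq_bigr => i _.
by rewrite linearZ; congr (_ *: _); exact: adj_delta.
Qed.

Let adjB phi psi : adj (phi - psi) = adj phi - adj psi.
Proof. exact/val_inj. Qed.

Let adj_free (phi : lip_free) : adj phi \in free_pred.
Proof.
have [k k0 adjk] := adj_bounded.
have k1 : 0 < k + 1 by rewrite ltr_wpDl.
apply/in_freeP => e e0.
have /in_freeP/(_ (e / (k + 1)))[|psi psis psie] := free_funP phi.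
  by rewrite divr_gt0.
exists (adj psi); first exact: adj_span.
rewrite -adjB (le_lt_trans (adjk _))//; rewrite ltr_pdivlMr// mulrC in psie.
by rewrite (le_lt_trans _ psie)// ler_wpM2r// lerDl.
Qed.

Lemma linearizationP : is_linearization f (linearization f).
Proof.
have [k k0 adjk] := adj_bounded.
pose T (phi : lip_free) : lip_free := Free (adj_free phi).
apply: (@xgetPex _ (fun=> 0) [set T | is_linearization f T]); exists T.
have Tl : linear T by move=> a phi psi; exact/val_inj/adj_linear.
split=> // [|x]; last exact/val_inj/adj_delta.
by apply: (@linear_le_continuous _ _ _ _ k) => // phi; exact: adjk.
Qed.

End Linearization.

Lemma linearization_unique f T1 T2 :
  is_linearization f T1 -> is_linearization f T2 -> T1 = T2.
Proof.
move=> [T1l T1c T1d] [T2l T2c T2d].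
pose F1 : {linear lip_free -> lip_free} :=
  HB.pack T1 (GRing.isLinear.Build _ _ _ _ _ T1l).
pose F2 : {linear lip_free -> lip_free} :=
  HB.pack T2 (GRing.isLinear.Build _ _ _ _ _ T2l).
have /linear_bounded_continuous/linear_boundedP/pinfty_ex_gt0[r1 r10 T1r] :
  continuous F1 := T1c.
have /linear_bounded_continuous/linear_boundedP/pinfty_ex_gt0[r2 r20 T2r] :
  continuous F2 := T2c.
apply/funext => phi; apply/eqP; rewrite -subr_eq0 -normr_le0.
apply/ler_addgt0Pl => e e0; rewrite addr0.
have r0 : 0 < r1 + r2 by rewrite addr_gt0.
have /in_freeP/(_ (e / (r1 + r2)))[|_ [n [a [x ->]]]] := free_funP phi.
  by rewrite divr_gt0.
set s := \sum_(i < n) a i *: fdelta (x i).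
have -> : \sum_(i < n) a i *: delta (x i) = val s.
  by rewrite /s raddf_sum.
move=> /ltW se.
have Es : F1 s = F2 s.
  rewrite !linear_sum; apply: eq_bigr => i _; rewrite !linearZ.
  by congr (_ *: _); rewrite [LHS]T1d [RHS]T2d.
have -> : T1 phi - T2 phi = F1 (phi - s) - F2 (phi - s).
  have LB (F : {linear lip_free -> lip_free}) : F (phi - s) = F phi - F s.
    exact: raddfB.
  by rewrite (LB F1) (LB F2) Es opprB addrA subrK.
rewrite (le_trans (ler_normB _ _))// (le_trans (lerD (T1r _) (T2r _)))//.
by rewrite -mulrDl mulrC -ler_pdivlMr.
Qed.

End LipschitzFree.

(* Main.v *)
Require Import Defs.
From HB Require Import structures.
From mathcomp Require Import all_boot all_order all_algebra.
From mathcomp Require Import all_classical all_reals all_analysis.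
From mathcomp Require Import zify.

(* [M] is the star with centre [o] whose leaves are the vertices, the leaf [v]
   being at distance [w v] from [o]; its free space is the [ell1] space with
   weight [w], the unit vectors being the evaluations at the leaves. Hence
   [e_v |-> c v * delta_v] is an isometry as soon as [w v = |mu v / c v|], and
   with [f v] the parent of [v] (the root and [o] being sent to [o]) it
   intertwines [B] and [T_f] on the unit vectors exactly when
   [c v = lambda v * c (parent v)]. This recursion has a nowhere zero solution
   because the tree is connected and has no cycle, and [f] is then Lipschitz
   because [B] is bounded on the unit vectors. Continuity does the rest. *)

Set Implicit Arguments.
Unset Strict Implicit.
Unset Printing Implicit Defensive.

Import Order.TTheory GRing.Theory Num.Theory.
Import numFieldNormedType.Exports.

Local Open Scope classical_set_scope.
Local Open Scope ring_scope.

(** * Linearity and monotonicity of signed sums of absolutely summable families *)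

Section RealSums.
Context (R : realType) (V : countType).
Implicit Types (D : set V) (a b p q : V -> R).

Lemma summable_le D a b : (forall u, D u -> `|a u| <= `|b u|) ->
  summable D (EFin \o b) -> summable D (EFin \o a).
Proof.
by move=> ab; apply: le_lt_trans; apply: le_esum => u Du; rewrite lee_fin ab.
Qed.

Lemma summable_add D a b : summable D (EFin \o a) -> summable D (EFin \o b) ->
  summable D (EFin \o (a \+ b)).
Proof. exact: summableD. Qed.

Lemma summable_scale D a (k : R) : summable D (EFin \o a) ->
  summable D (EFin \o (fun u => k * a u)).
Proof.
move=> sa; rewrite /summable (_ : esum _ _ =
    `|k|%:E * \esum_(u in D) `|(a u)%:E|)%E; last first.
  by rewrite -esumZl//; apply: eq_esum => u _; rewrite /= normrM EFinM.
by move: sa; rewrite summableE => /fineK <-; rewrite -EFinM ltry.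
Qed.

Lemma summable_ge0_fin_num D p : (forall u, 0 <= p u) ->
  summable D (EFin \o p) -> (\esum_(u in D) (p u)%:E)%E \is a fin_num.
Proof.
move=> p0; rewrite summableE; congr (is_true (_ \is a fin_num)).
by apply: eq_esum => u _; rewrite /= ger0_norm.
Qed.

(** Positive and negative parts do not add up under addition of families. Freeing [rsum] from that
    particular decomposition is what makes additivity and scaling reducible to non-negative
    families. *)
Lemma rsum_sub D a p q : (forall u, 0 <= p u) -> (forall u, 0 <= q u) ->
  summable D (EFin \o p) -> summable D (EFin \o q) ->
  (forall u, a u = p u - q u) ->
  rsum D a = fine (\esum_(u in D) (p u)%:E)%E - fine (\esum_(u in D) (q u)%:E)%E.
Proof.
move=> p0 q0 sp sq aE.
have -> : a = (fun u => p u - q u) by exact/funext.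
have sa := summableB sp sq.
have fp := summable_ge0_fin_num p0 sp; have fq := summable_ge0_fin_num q0 sq.
have abs_ge0 (g : V -> \bar R) : (forall u, 0 <= g u)%E -> summable D g ->
    (\esum_(u in D) g u)%E \is a fin_num.
  move=> g0; rewrite summableE; congr (is_true (_ \is a fin_num)).
  by apply: eq_esum => u _; rewrite gee0_abs.
rewrite /rsum -!fineB//.
- have := esumB sp sq (fun u _ => p0 u) (fun u _ => q0 u).
  by move=> /(congr1 fine).
- apply: abs_ge0 => [u|]; [exact: funepos_ge0|exact: summable_funepos].
- apply: abs_ge0 => [u|]; [exact: funeneg_ge0|exact: summable_funeneg].
Qed.

Lemma rsum_ge0E D p : (forall u, 0 <= p u) -> summable D (EFin \o p) ->
  rsum D p = fine (\esum_(u in D) (p u)%:E)%E.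
Proof.
move=> p0 sp; rewrite (@rsum_sub D p p (fun=> 0))//.
- by rewrite [X in _ - fine X]esum1 ?subr0.
- by rewrite /summable esum1 ?ltry// => u _; rewrite /= normr0.
- by move=> u; rewrite subr0.
Qed.

Lemma ler_rsum_ge0 D p q : (forall u, 0 <= p u) -> (forall u, p u <= q u) ->
  summable D (EFin \o q) -> rsum D p <= rsum D q.
Proof.
move=> p0 pq sq; have q0 u : 0 <= q u by exact: le_trans (pq u).
have sp : summable D (EFin \o p).
  by apply: summable_le sq => u _; rewrite !ger0_norm.
rewrite !rsum_ge0E// fine_le ?summable_ge0_fin_num//.
by apply: le_esum => u _; rewrite lee_fin.
Qed.

Lemma rsum_ge0 D p : (forall u, 0 <= p u) -> summable D (EFin \o p) ->
  0 <= rsum D p.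
Proof. by move=> p0 sp; rewrite rsum_ge0E//; apply/fine_ge0/esum_ge0 => u _; rewrite lee_fin.
Qed.

Lemma rsum_ge0D D p q : (forall u, 0 <= p u) -> (forall u, 0 <= q u) ->
  summable D (EFin \o p) -> summable D (EFin \o q) ->
  rsum D (fun u => p u + q u) = rsum D p + rsum D q.
Proof.
move=> p0 q0 sp sq; rewrite !rsum_ge0E//; last 2 first.
- by move=> u; rewrite addr_ge0.
- exact: summable_add.
rewrite -fineD ?summable_ge0_fin_num// -esumD// => u _; by rewrite lee_fin.
Qed.

Lemma rsum_ge0Z D p (k : R) : 0 <= k -> (forall u, 0 <= p u) ->
  summable D (EFin \o p) -> rsum D (fun u => k * p u) = k * rsum D p.
Proof.
move=> k0 p0 sp; rewrite !rsum_ge0E//; last 2 first.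
- by move=> u; rewrite mulr_ge0.
- exact: summable_scale.
rewrite -[k in RHS]/(fine k%:E) -fineM ?summable_ge0_fin_num//.
by congr fine; rewrite -esumZl//.
Qed.

(** Real-valued parts, so that the rules above for non-negative real families apply to them. *)
Let pos a u := Num.max (a u) 0.
Let neg a u := Num.max (- a u) 0.

Let pos_ge0 a u : 0 <= pos a u. Proof. by rewrite le_max lexx orbT. Qed.
Let neg_ge0 a u : 0 <= neg a u. Proof. by rewrite le_max lexx orbT. Qed.

Let posBneg a u : a u = pos a u - neg a u.
Proof.
rewrite /pos /neg; have [a0|/ltW a0] := leP 0 (a u).
  by rewrite max_r ?oppr_le0// subr0.
by rewrite max_l ?oppr_ge0// sub0r opprK.
Qed.

Let pos_summable D a : summable D (EFin \o a) -> summable D (EFin \o pos a).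
Proof.
apply: summable_le => u _; rewrite ger0_norm// ge_max normr_ge0 andbT.
exact: ler_norm.
Qed.

Let neg_summable D a : summable D (EFin \o a) -> summable D (EFin \o neg a).
Proof.
apply: summable_le => u _; rewrite ger0_norm// ge_max normr_ge0 andbT.
by rewrite -normrN ler_norm.
Qed.

Let rsum_posneg D a p q : (forall u, 0 <= p u) -> (forall u, 0 <= q u) ->
  summable D (EFin \o p) -> summable D (EFin \o q) ->
  (forall u, a u = p u - q u) -> rsum D a = rsum D p - rsum D q.
Proof. by move=> *; rewrite (@rsum_sub D a p q)// -!rsum_ge0E. Qed.

Lemma rsumD D a b : summable D (EFin \o a) -> summable D (EFin \o b) ->
  rsum D (fun u => a u + b u) = rsum D a + rsum D b.
Proof.
move=> sa sb; have [pa na] := (pos_summable sa, neg_summable sa).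
have [pb nb] := (pos_summable sb, neg_summable sb).
rewrite (@rsum_posneg D _ (pos a \+ pos b) (neg a \+ neg b)).
- rewrite !rsum_ge0D// (rsum_posneg (a := a) _ _ pa na)//.
  rewrite (rsum_posneg (a := b) _ _ pb nb)//.
  by rewrite opprD addrACA.
- by move=> u; rewrite addr_ge0.
- by move=> u; rewrite addr_ge0.
- exact: summable_add.
- exact: summable_add.
- by move=> u /=; rewrite {1}(posBneg a) {1}(posBneg b) opprD addrACA.
Qed.

Lemma rsumZ D a (k : R) : summable D (EFin \o a) ->
  rsum D (fun u => k * a u) = k * rsum D a.
Proof.
move=> sa; have [pa na] := (pos_summable sa, neg_summable sa).
rewrite (rsum_posneg (a := a) _ _ pa na)//.
have [k0|/ltW k0] := leP 0 k.
  rewrite mulrBr -!rsum_ge0Z//.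
  apply: rsum_posneg => [u|u|||u]; rewrite ?mulr_ge0//; try exact: summable_scale.
  by rewrite -mulrBr -posBneg.
(* A negative factor exchanges the two parts: [k * a] is [- k * neg a] minus [- k * pos a]. *)
rewrite -[in RHS](opprK k) mulNr -mulrN opprB mulrBr -!rsum_ge0Z ?oppr_ge0//.
apply: rsum_posneg => [u|u|||u]; rewrite ?mulr_ge0 ?oppr_ge0//;
  try exact: summable_scale.
by rewrite -mulrBr -opprB mulrNN -posBneg.
Qed.

Lemma ler_norm_rsum D a : summable D (EFin \o a) ->
  `|rsum D a| <= rsum D (fun u => `|a u|).
Proof.
move=> sa; have [pa na] := (pos_summable sa, neg_summable sa).
rewrite (rsum_posneg (a := a) _ _ pa na)// (le_trans (ler_normB _ _))//.
rewrite !ger0_norm ?rsum_ge0// -rsum_ge0D//.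
have -> : (fun u => pos a u + neg a u) = (fun u => `|a u|) => //.
apply/funext => u; rewrite /pos /neg; have [a0|/ltW a0] := leP 0 (a u).
  by rewrite max_r ?oppr_le0// addr0 ger0_norm.
by rewrite max_l ?oppr_ge0// add0r ler0_norm.
Qed.

Lemma rsum_single D v (t : R) :
  summable D (EFin \o (fun u => if u == v then t else 0)) /\
  rsum D (fun u => if u == v then t else 0) = if v \in D then t else 0.
Proof.
have E (k : R) : 0 <= k -> (\esum_(u in D) (if u == v then k else 0)%:E)%E =
    (if v \in D then k else 0)%:E.
  move=> k0; rewrite esum_mkcond [RHS](_ : _ =
      (\esum_(u in [set v]) (if u \in D then k%:E else 0))%E); last first.
    by rewrite esum_set1; case: ifP; rewrite ?lee_fin.
  rewrite [RHS]esum_mkcond; apply: eq_esum => u _; rewrite in_set1.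
  by case: eqP => [->|_]; case: ifP.
have s (k : R) : summable D (EFin \o (fun u => if u == v then k else 0)).
  rewrite /summable (_ : esum _ _ = (if v \in D then `|k| else 0)%:E) ?ltry//.
  by rewrite -E//; apply: eq_esum => u _ /=; case: eqP => //; rewrite normr0.
(* The sign of [t] is arbitrary, so [t] is taken out of the sum and only the non-negative indicator
   of [v] is summed. *)
split=> //; have -> : (fun u => if u == v then t else 0) =
    (fun u => t * if u == v then 1 else 0).
  by apply/funext => u; case: eqP; rewrite ?mulr1 ?mulr0.
rewrite rsumZ// rsum_ge0E//; last by move=> u; case: eqP.
by rewrite E//=; case: ifP; rewrite ?mulr1 ?mulr0.
Qed.

End RealSums.

(** * Ascent in the tree and the weight recursion along its edges *)

Section TreePotential.
Context (V : countType) (E : rel V) (E_tree : directed_tree E).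

Definition parent (v : V) : option V :=
  if pselect (exists w, E w v) is left h then Some (xchoose h) else None.

Lemma parent_Some v w : E w v -> parent v = Some w.
Proof.
rewrite /parent => Ewv; case: pselect => [h|[]]; last by exists w.
by congr Some; exact: (parent_unique E_tree (xchooseP h) Ewv).
Qed.

Lemma parent_None v : is_root E v -> parent v = None.
Proof.
by rewrite /parent => rv; case: pselect => // -[w Ewv]; have := rv w; rewrite Ewv.
Qed.

Lemma parentP v : is_root E v \/ exists w, E w v.
Proof.
have [h|h] := pselect (exists w, E w v); first by right.
by left=> w; apply/negP => Ewv; apply: h; exists w.
Qed.

(** Roots are fixed, which makes [up] total: an ascent of any length is defined and stops moving
    once it meets the root. *)
Let up v := odflt v (parent v).

Let up_edge v w : E w v -> up v = w.
Proof. by rewrite /up => /parent_Some ->. Qed.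

Let up_root v : is_root E v -> up v = v.
Proof. by rewrite /up => /parent_None ->. Qed.

Let iter_up_root v n : is_root E v -> iter n up v = v.
Proof. by move=> rv; elim: n => //= n ->; exact: up_root. Qed.

(** Otherwise a shortest return of the ascent to [v] would trace a directed cycle of distinct
    vertices. *)
Let periodic_root v n : (0 < n)%N -> iter n up v = v -> is_root E v.
Proof.
move=> n0 vn; have ex : exists k, (0 < k)%N && (iter k up v == v).
  by exists n; rewrite n0 vn eqxx.
have [k /andP[k0 /eqP vk] kmin] := ex_minnP ex.
(* A root met on the way absorbs the ascent; as the ascent comes back to [v], that root is [v]. *)
have [[i [ik ri]]|nr] := pselect (exists i, (i <= k)%N /\ is_root E (iter i up v)).
  by rewrite -vk -(subnK ik) iterD iter_up_root.
have Eup i : (i < k)%N -> E (up (iter i up v)) (iter i up v).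
  move=> ik; have [ri|[w Ew]] := parentP (iter i up v).
    by case: nr; exists i; rewrite (ltnW ik).
  by rewrite (up_edge Ew).
(* Edges point from parent to child, against [up], so the orbit is read backwards. *)
have cyc : cycle E (rev (traject up v k)).
  rewrite rev_cycle; case: k k0 vk Eup {kmin nr} => //= k _ vk Eup.
  have {3}<- : iter k up (up v) = v by rewrite -iterSr.
  rewrite -trajectSr.
  apply/(pathP v) => i; rewrite size_traject => ik.
  rewrite -trajectS nth_traject 1?ltnW//.
  rewrite (set_nth_default (up v)) ?size_traject// nth_traject//.
  by have := Eup i ik; rewrite -iterS iterSr.
have /(edge_acyclic E_tree cyc) : uniq (rev (traject up v k)).
  rewrite rev_uniq; apply/(uniqP v) => i j; rewrite !inE size_traject => ik jk.
  rewrite !nth_traject//.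
  wlog ij : i j ik jk / (i <= j)%N.
    move=> H; have [ij|/ltnW ij /esym] := leqP i j; first exact: H.
    by move/(H j i jk ik ij).
  move=> eij; apply/eqP; rewrite eqn_leq ij/= leqNgt; apply/negP => lij.
  (* A repetition at [i < j] would give the positive period [k - j + i], smaller than the least one
     [k]. *)
  have := kmin (k - j + i)%N; rewrite iterD eij -iterD (subnK (ltnW jk)) vk eqxx.
  by rewrite addn_gt0 subn_gt0 jk/= => /(_ isT); lia.
by move=> /(congr1 size); rewrite size_rev size_traject; case: k k0 {vk kmin nr Eup cyc}.
Qed.

Section Weights.
Context (R : realType) (lambda : V -> R).
Hypothesis lambda0 : forall v, ~ is_root E v -> lambda v != 0.

(** The value 1 at the root keeps the products below unchanged while an ascent waits there. *)
Let l v := if parent v is Some _ then lambda v else 1.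

Let l_edge v w : E w v -> l v = lambda v.
Proof. by rewrite /l => /parent_Some ->. Qed.

Let l_root v : is_root E v -> l v = 1.
Proof. by rewrite /l => /parent_None ->. Qed.

Let l_neq0 v : l v != 0.
Proof.
have [rv|[w Ew]] := parentP v; first by rewrite l_root// oner_neq0.
by rewrite (l_edge Ew) lambda0// => /(_ w); rewrite Ew.
Qed.

Let L n v := \prod_(i < n) l (iter i up v).

Let L_neq0 n v : L n v != 0.
Proof. by apply/prodf_neq0 => i _; exact: l_neq0. Qed.

Let LD m n v : L (m + n) v = L m v * L n (iter m up v).
Proof.
rewrite /L big_split_ord /=; congr (_ * _); apply: eq_bigr => i _.
by rewrite addnC iterD.
Qed.

Let L_root n v : is_root E v -> L n v = 1.
Proof.
by move=> rv; rewrite /L big1// => i _; rewrite iter_up_root// l_root.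
Qed.

(** If the lengths differ, the surplus steps lead from a vertex back to itself; that vertex is then
    a root, where all factors are 1. *)
Let L_eq m n v : iter m up v = iter n up v -> L m v = L n v.
Proof.
wlog mn : m n / (m <= n)%N.
  move=> H; have [mn|/ltnW mn /esym] := leqP m n; first exact: H.
  by move/(H n m mn).
move=> e; have [k0|k0] := posnP (n - m).
  by congr L; apply/eqP; rewrite eqn_leq mn -subn_eq0 k0.
rewrite -(subnKC mn) LD [X in _ * X]L_root ?mulr1//.
by apply: (periodic_root k0); rewrite -iterD (subnK mn).
Qed.

(** The two ends of an edge have a common iterate, and having one is a transitive relation because
    iterates of [up] commute; connectedness chains the edges together. *)
Let common_ancestor u v : exists m n, iter m up u = iter n up v.
Proof.
have trans x y z : (exists m n, iter m up x = iter n up y) ->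
    (exists m n, iter m up y = iter n up z) ->
    exists m n, iter m up x = iter n up z.
  move=> [m [n e]] [m' [n' e']]; exists (m' + m)%N, (n + n')%N.
  by rewrite !iterD e -e' -!iterD addnC.
have [p] := edge_connected E_tree u v.
elim: p u => [u _ <-|x p IH u /= /andP[uEx px] xv]; first by exists 0%N, 0%N.
apply: trans (IH x px xv).
by case/orP: uEx => [/up_edge e|/up_edge e]; [exists 0%N, 1%N|exists 1%N, 0%N].
Qed.

(* [c u / c v0] compares the products of the weights on the ways from [u] and
   [v0] up to a common ancestor; it does not depend on the ancestor. *)
Lemma tree_potential : exists c : V -> R,
  (forall v, c v != 0) /\ (forall v w, E w v -> c v = lambda v * c w).
Proof.
have [[v0 _]|noV] := pselect (exists v : V, True); last first.
  by exists (fun=> 1); split=> v; case: noV; exists v.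
have /choice[h hP] u : exists mn : nat * nat, iter mn.1 up u = iter mn.2 up v0.
  by have [m [n e]] := common_ancestor u v0; exists (m, n).
pose c u := L (h u).1 u / L (h u).2 v0.
have cE u m n : iter m up u = iter n up v0 -> c u = L m u / L n v0.
  move: (hP u); rewrite /c; move: (h u).1 (h u).2 => m' n'.
  suff H i j i' j' : (i <= i')%N -> iter i up u = iter j up v0 ->
      iter i' up u = iter j' up v0 -> L i u / L j v0 = L i' u / L j' v0.
    by move=> e' e; have [mm|/ltnW mm] := leqP m m'; [symmetry|]; apply: H.
  move=> ii e e'; rewrite -(subnKC ii) LD e.
  (* Beyond the first common ancestor both ascents make the same [i' - i] steps, whose factor
     cancels in the quotient. [L_eq] takes care of a [j'] that differs from [j + (i' - i)]. *)
  have <- : L (j + (i' - i)) v0 = L j' v0.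
    by apply: L_eq; rewrite addnC iterD -e -iterD subnK.
  by rewrite LD invfM mulrACA divff ?mulr1.
exists c; split=> [v|v w Ewv]; first by rewrite mulf_neq0 ?invr_neq0.
(* The ancestor chosen for [w] also serves [v], one step later; the extra factor is [lambda v]. *)
rewrite (cE v (h w).1.+1 (h w).2); last by rewrite iterSr (up_edge Ewv).
by rewrite -addn1 addnC LD /= (up_edge Ewv) /L big_ord1 /= (l_edge Ewv) mulrA.
Qed.

End Weights.
End TreePotential.

(** * Unit vectors of the weighted space and density of their span *)

Section Ell1Basis.
Context (R : realType) (V : countType) (mu : V -> R) (mu0 : forall v, mu v != 0).
Implicit Types x y : ell1 mu0.

Lemma ell1_summable x : summable [set: V] (EFin \o (fun v => x v * mu v)).
Proof. by have := ell1_funP x; rewrite inE. Qed.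

Lemma ell1_normE x : `|x| = rsum [set: V] (fun v => `|x v * mu v|).
Proof.
rewrite rsum_ge0E//; apply: summable_le (ell1_summable x) => v _.
by rewrite normr_id.
Qed.

Lemma ell1_norm_le (x : ell1 mu0) (k : R) :
  (forall s : seq V, uniq s -> \sum_(v <- s) `|x v * mu v| <= k) -> `|x| <= k.
Proof.
move=> xk; have sx := ell1_summable x.
rewrite -lee_fin -[`|x|]/(ell1_norm x) /ell1_norm fineK -?summableE//.
apply: ge_ereal_sup => _ [A [fA _] <-].
by rewrite fsbig_finite//= sumEFin lee_fin xk// finmap.fset_uniq.
Qed.

Fact ell1_unit_subproof (v : V) : (fun u => if u == v then 1 else 0) \in ell1_pred mu.
Proof.
rewrite inE /=.
have [+ _] := rsum_single [set: V] v (mu v); congr summable.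
by apply/funext => u /=; case: eqP => [->|_]; rewrite ?mul1r ?mul0r.
Qed.

Definition ell1_unit (v : V) : ell1 mu0 := Ell1 mu0 (ell1_unit_subproof v).

Lemma ell1_norm_unit v : `|ell1_unit v| = `|mu v|.
Proof.
rewrite ell1_normE; have [_] := rsum_single [set: V] v `|mu v|; rewrite in_setT => <-.
congr rsum; apply/funext => u /=; case: eqP => [->|_]; first by rewrite mul1r.
by rewrite mul0r normr0.
Qed.

Lemma ell1_sumE (I : Type) (s : seq I) (f : I -> ell1 mu0) v :
  (\sum_(i <- s) f i) v = \sum_(i <- s) f i v.
Proof.
by elim: s => [|i s IH]; rewrite ?big_nil// !big_cons -IH.
Qed.

(** The norm is a supremum of finite partial sums. Let [y] be the restriction of [x] to a finite set
    whose partial sum is within [e] of the norm. As [y] and [x - y] have disjoint supports, their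
    norms add up to that of [x], so [x - y] has norm below [e]. *)
Lemma ell1_approx x e : 0 < e ->
  exists s : seq V, `|x - \sum_(v <- s) x v *: ell1_unit v| < e.
Proof.
move=> e0; have sx := ell1_summable x.
have fx : (\esum_(v in [set: V]) `|(x v * mu v)%:E|)%E \is a fin_num.
  by rewrite -summableE.
have [_ [A [fA _] <-]] := ub_ereal_sup_adherent e0 fx.
rewrite -/(esum _ _) -[esum _ _]fineK// -/(ell1_norm x) -[ell1_norm x]/`|x|.
rewrite fsbig_finite//= sumEFin -EFinB lte_fin => xe.
exists (finmap.enum_fset (fset_set A)); set y := \sum_(v <- _) _.
have yE v : y v = if v \in A then x v else 0.
  rewrite /y ell1_sumE; under eq_bigr do rewrite -[_ v]/(_ * if _ then _ else _).
  case: ifPn => vA.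
    rewrite (bigD1_seq v) ?finmap.fset_uniq ?in_fset_set//= eqxx mulr1.
    by rewrite big1 ?addr0// => u; rewrite eq_sym => /negPf ->; rewrite mulr0.
  rewrite big_seq big1// => u; rewrite in_fset_set// => uA.
  by case: eqP => [vu|]; rewrite ?mulr0//; move: vA; rewrite vu uA.
have xyE v : (x - y) v = if v \in A then 0 else x v.
  by rewrite -[LHS]/(x v - y v) yE; case: ifP; rewrite ?subrr ?subr0.
have snorm (z : ell1 mu0) : summable [set: V] (EFin \o (fun v => `|z v * mu v|)).
  by apply: summable_le (ell1_summable z) => v _; rewrite normr_id.
have xD : `|x| = `|y| + `|x - y|.
  rewrite !ell1_normE -rsum_ge0D//; congr rsum; apply/funext => v.
  by rewrite yE xyE; case: ifP; rewrite ?mul0r ?normr0 ?addr0 ?add0r.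
have yA : \sum_(v <- finmap.enum_fset (fset_set A)) `|x v * mu v| <= `|y|.
  rewrite -lee_fin -[`|y|]/(ell1_norm y) /ell1_norm fineK; last first.
    by rewrite -summableE; exact: (ell1_summable y).
  apply: ereal_sup_ubound; exists A; first by split.
  rewrite fsbig_finite//= sumEFin; congr EFin; apply: eq_big_seq => v.
  by rewrite in_fset_set// => vA; rewrite yE vA.
move: (lt_le_trans xe yA); rewrite xD; rewrite ltrBlDr.
by rewrite ltrD2l.
Qed.

(** Density of the span of the unit vectors, in the form of an induction principle for properties
    closed under linear combinations and limits. *)
Lemma ell1_ind (P : ell1 mu0 -> Prop) : P 0 ->
  (forall a x y, P x -> P y -> P (a *: x + y)) ->
  (forall v, P (ell1_unit v)) ->
  (forall x, (forall e, 0 < e -> exists2 y, P y & `|x - y| < e) -> P x) ->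
  forall x, P x.
Proof.
move=> P0 PD Pu Pc x; apply: Pc => e /(ell1_approx x)[s xs].
exists (\sum_(v <- s) x v *: ell1_unit v) => //.
elim: s {xs} => [|v s IH]; first by rewrite big_nil.
by rewrite big_cons; exact: PD.
Qed.

End Ell1Basis.

(** * The star as a metric space and its Lipschitz maps *)

Section Star.
Context (R : realType) (V : countType) (w : V -> R).

(* The star with centre [None], whose branch at [v] has length [w v]. *)
Definition star (w0 : forall v, 0 < w v) : Type := option V.

Context (w0 : forall v, 0 < w v).
Local Notation M := (star w0).

HB.instance Definition _ := Choice.on M.

Definition star_height (x : M) : R := if x is Some v then w v else 0.

Definition star_dist (x y : M) : R :=
  if x == y then 0 else star_height x + star_height y.

Lemma star_height_ge0 x : 0 <= star_height x.
Proof. by case: x => //= v; exact: ltW. Qed.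

Fact star_distxx x : star_dist x x = 0.
Proof. by rewrite /star_dist eqxx. Qed.

Fact star_dist_positivity x y : star_dist x y = 0 -> x = y.
Proof.
rewrite /star_dist; case: eqP => // _ /eqP.
rewrite paddr_eq0 ?star_height_ge0//.
by case: x y => [v|] [u|] //=; rewrite !(gt_eqF (w0 _)) ?andbF.
Qed.

Fact star_dist_sym x y : star_dist x y = star_dist y x.
Proof. by rewrite /star_dist eq_sym addrC. Qed.

Fact star_dist_triangle y x z : star_dist x z <= star_dist x y + star_dist y z.
Proof.
rewrite /star_dist; have h0 := star_height_ge0.
have [->|xy] := eqVneq x y; first by rewrite add0r.
have [->|yz] := eqVneq y z; first by rewrite addr0; case: ifP; rewrite ?addr_ge0.
have [_|_] := eqVneq x z; first by rewrite !addr_ge0.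
by rewrite -addrA lerD2l addrA lerDr addr_ge0.
Qed.

HB.instance Definition _ := isMetric.Build R M
  star_distxx star_dist_positivity star_dist_sym star_dist_triangle.

Local Notation o := (None : M).
Local Notation leaf v := (Some v : M).

Lemma star_mdistE (x y : M) : mdist x y = star_dist x y.
Proof. by []. Qed.

Lemma star_lip0_le (g : lip0 o) v : `|g (leaf v)| <= `|g| * w v.
Proof.
have := ler_lip_const g (leaf v) o.
by rewrite lip0_base subr0 star_mdistE /star_dist /= addr0.
Qed.

(** Distinct points are joined through the centre, so the slopes along the branches alone decide the
    Lipschitz constant. *)
Lemma star_lip_le (g : M -> R) (k : R) : g o = 0 ->
  (forall v, `|g (leaf v)| <= k * w v) ->
  forall x y, `|g x - g y| <= k * mdist x y.
Proof.
move=> go gk x y; rewrite star_mdistE /star_dist.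
have [->|_] := eqVneq x y; first by rewrite subrr normr0 mulr0.
have H z : `|g z| <= k * star_height z.
  by case: z => [v|] //=; rewrite go normr0 mulr0.
by rewrite mulrDr (le_trans (ler_normB _ _))// lerD.
Qed.

Fact star_fun_subproof (a : V -> R) (k : R) (ak : forall v, `|a v| <= k * w v) :
  (fun x : M => if x is Some v then a v else 0) \in lip_pred o.
Proof. by rewrite inE; split=> //; exists k; exact: star_lip_le. Qed.

Definition star_fun (a : V -> R) (k : R) (ak : forall v, `|a v| <= k * w v) :
  lip0 o := Lip0 (star_fun_subproof ak).

(** The constant is the slope of the only branch on which the bump is not zero: it rises by 1 over
    the length [w v]. *)
Fact star_bump_subproof (v u : V) :
  `|(if u == v then 1 else 0) : R| <= (w v)^-1 * w u.
Proof.
case: eqP => [->|_]; first by rewrite normr1 mulVf// gt_eqF.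
by rewrite normr0 mulr_ge0 ?invr_ge0 ?ltW.
Qed.

Definition star_bump (v : V) : lip0 o := star_fun (star_bump_subproof v).

Lemma star_self_lip (f : M -> M) (k : R) : 0 <= k -> f o = o ->
  (forall v, star_height (f (leaf v)) <= k * w v) -> lip_self o f.
Proof.
move=> k0 fo fk; split=> //; exists k => x y; rewrite !star_mdistE /star_dist.
have [->|_] := eqVneq x y; first by rewrite eqxx mulr0.
have H z : star_height (f z) <= k * star_height z.
  by case: z => [v|] //=; rewrite fo /= mulr0.
case: ifP => _; first by rewrite mulr_ge0// addr_ge0// star_height_ge0.
by rewrite mulrDr lerD.
Qed.

End Star.

(** * The isometry between the weighted space and the free space of the star *)

Section FreeStar.
Context (R : realType) (V : countType) (mu c : V -> R).
Context (mu0 : forall v, mu v != 0) (c0 : forall v, c v != 0).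

Fact star_weight_gt0 v : 0 < `|mu v / c v|.
Proof. by rewrite normr_gt0 mulf_neq0 ?invr_neq0. Qed.

Local Notation M := (star star_weight_gt0).
Local Notation o := (None : M).
Local Notation leaf v := (Some v : M).
Implicit Types (x y : ell1 mu0) (g : lip0 o) (phi : topdual (lip0 o)).

(** The branch length [|mu v / c v|] bounds [g] at the leaf and cancels the factor [c v]. *)
Let term_le x g v : `|c v * x v * g (leaf v)| <= `| `|g| * (x v * mu v)|.
Proof.
rewrite !normrM normr_id [leRHS]mulrC -!mulrA [leLHS]mulrCA ler_wpM2l//.
rewrite (le_trans (ler_wpM2l (normr_ge0 _) (star_lip0_le g v)))//.
by rewrite mulrCA -normrM mulrCA divff// mulr1 mulrC.
Qed.

Let term_summable x g :
  summable [set: V] (EFin \o (fun v => c v * x v * g (leaf v))).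
Proof.
apply: summable_le (summable_scale `|g| (ell1_summable x)) => v _.
exact: term_le.
Qed.

Let pairing x g := rsum [set: V] (fun v => c v * x v * g (leaf v)).

Let pairing_le x g : `|pairing x g| <= `|x| * `|g|.
Proof.
have sx : summable [set: V] (EFin \o (fun v => `|x v * mu v|)).
  by apply: summable_le (ell1_summable x) => v _; rewrite normr_id.
rewrite (le_trans (ler_norm_rsum (term_summable x g)))//.
rewrite mulrC ell1_normE -rsumZ//; apply: ler_rsum_ge0 => // [v|].
  by rewrite (le_trans (term_le x g v))// normrM normr_id.
exact: summable_scale.
Qed.

Let pairing_linearr x : linear (pairing x).
Proof.
move=> a g h; rewrite -[RHS]/(a * pairing x g + pairing x h) /pairing.
rewrite -rsumZ// -rsumD//.
  by congr rsum; apply/funext => v; rewrite mulrDr; congr (_ + _); rewrite mulrCA.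
exact: summable_scale.
Qed.

Let pairing_linearl g a x y : pairing (a *: x + y) g = a * pairing x g + pairing y g.
Proof.
rewrite /pairing -rsumZ// -rsumD//; last exact: summable_scale.
congr rsum; apply/funext => v.
by rewrite -[(a *: x + y) v]/(a * x v + y v) mulrDr mulrDl mulrCA !mulrA.
Qed.

Let pairing_subproof x : pairing x \in @dual_pred R (lip0 o).
Proof.
rewrite inE; split; first exact: pairing_linearr.
apply: linear_le_continuous; first exact: pairing_linearr.
exact: pairing_le.
Qed.

Let Psi x : topdual (lip0 o) := Dual (pairing_subproof x).

Let PsiD a x y : Psi (a *: x + y) = a *: Psi x + Psi y.
Proof. by apply/val_inj/funext => g /=; exact: pairing_linearl. Qed.

Let PsiB x y : Psi (x - y) = Psi x - Psi y.
Proof. by rewrite -scaleN1r addrC PsiD scaleN1r addrC. Qed.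

Let Psi_norm_le x : `|Psi x| <= `|x|.
Proof. by apply: opnorm_le => // g; exact: pairing_le. Qed.

Let Psi_unit v : Psi (ell1_unit mu0 v) = c v *: delta o (leaf v).
Proof.
apply/val_inj/funext => g /=.
have [_] := rsum_single [set: V] v (c v * g (leaf v)); rewrite in_setT => H.
rewrite -[RHS]/(c v * g (leaf v)) -H /pairing; congr rsum; apply/funext => u /=.
by case: eqP => [->|_]; rewrite ?mulr1 // mulr0 mul0r.
Qed.

Let bump v : lip0 o := star_bump star_weight_gt0 v.

(** Inverse candidate for [Psi]: the bump at [v] vanishes at all other leaves, so [Psi x] sends it
    to [c v * x v]. *)
Let coord phi v := phi (bump v) / c v.

Let coord_Psi x v : coord (Psi x) v = x v.
Proof.
have [_] := rsum_single [set: V] v (c v * x v); rewrite in_setT => H.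
have xv : pairing x (bump v) = c v * x v.
  rewrite -[RHS]H /pairing; congr rsum; apply/funext => u /=.
  by case: eqP => [->|_]; rewrite ?mulr1 ?mulr0.
by rewrite /coord -[X in X / _]/(pairing x (bump v)) xv mulrAC divff ?mul1r.
Qed.

Let dual_sum phi (s : seq V) (f : V -> lip0 o) :
  phi (\sum_(v <- s) f v) = \sum_(v <- s) phi (f v).
Proof.
pose F : {linear lip0 o -> R} :=
  HB.pack (dual_fun phi) (GRing.isLinear.Build _ _ _ _ _ (dual_linear phi)).
exact: (linear_sum F).
Qed.

Let dual_scale phi a g : phi (a *: g) = a * phi g.
Proof.
pose F : {linear lip0 o -> R} :=
  HB.pack (dual_fun phi) (GRing.isLinear.Build _ _ _ _ _ (dual_linear phi)).
exact: (linearZ_LR F).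
Qed.

Let lip0_sumE (s : seq V) (f : V -> lip0 o) z :
  (\sum_(v <- s) f v) z = \sum_(v <- s) f v z.
Proof. by elim: s => [|v s IH]; rewrite ?big_nil// !big_cons -IH. Qed.

(* Testing [phi] on the 1-Lipschitz function with values
   [sgn (coord phi v * mu v) * mu v / c v] at the leaves in [s]. *)
Let coord_sum phi (s : seq V) : uniq s ->
  \sum_(v <- s) `|coord phi v * mu v| <= `|phi|.
Proof.
move=> us; pose a v := Num.sg (coord phi v * mu v) * (mu v / c v).
pose g : lip0 o := \sum_(v <- s) a v *: bump v.
have -> : \sum_(v <- s) `|coord phi v * mu v| = phi g.
  rewrite dual_sum; apply: eq_bigr => v _; rewrite dual_scale normrEsg /a.
  rewrite /coord -!mulrA; congr (_ * _).
  by rewrite [LHS]mulrC [_^-1 * mu v]mulrC mulrA.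
have g1 : `|g| <= 1.
  apply: lip_const_le => //; apply: star_lip_le; first exact: lip0_base.
  move=> v; have -> : g (leaf v) = \sum_(u <- s) a u * if v == u then 1 else 0.
    by rewrite lip0_sumE.
  rewrite mul1r.
  have [vs|vs] := boolP (v \in s).
    rewrite (bigD1_seq v)//= eqxx mulr1 big1 => [|u]; last first.
      by rewrite eq_sym => /negPf ->; rewrite mulr0.
    by rewrite addr0 normrM normr_sg ler_piMl// lern1 leq_b1.
  rewrite big_seq big1 ?normr0// => u us'.
  by case: eqP => [vu|]; rewrite ?mulr0//; move: vs; rewrite vu us'.
rewrite (le_trans (ler_norm _))// (le_trans (ler_opnorm phi g))//.
by rewrite -[leRHS]mulr1; apply: ler_wpM2l => //; exact: opnorm_ge0.
Qed.

(** Every finite partial sum is at most the norm of [phi], so even functionals outside the free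
    space have summable coordinates. *)
Let coord_subproof phi : coord phi \in ell1_pred mu.
Proof.
rewrite inE; apply: (@le_lt_trans _ _ `|phi|%:E); last by rewrite ltry.
apply: ge_ereal_sup => _ [A [fA _] <-].
by rewrite fsbig_finite//= sumEFin lee_fin coord_sum// finmap.fset_uniq.
Qed.

Let Coord phi : ell1 mu0 := Ell1 mu0 (coord_subproof phi).

Let Coord_norm_le phi : `|Coord phi| <= `|phi|.
Proof. by apply: ell1_norm_le => s; exact: coord_sum. Qed.

Let Coord_Psi x : Coord (Psi x) = x.
Proof. by apply/val_inj/funext => v; exact: coord_Psi. Qed.

Let CoordB phi psi : Coord (phi - psi) = Coord phi - Coord psi.
Proof. by apply/val_inj/funext => v; exact: mulrBl. Qed.

(** Both [Psi] and its left inverse [Coord] are contractions. *)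
Let Psi_norm x : `|Psi x| = `|x|.
Proof. by apply/eqP; rewrite eq_le Psi_norm_le -{1}[x]Coord_Psi Coord_norm_le. Qed.

Let Psi0 : Psi 0 = 0.
Proof. by apply/eqP; rewrite -normr_eq0 Psi_norm normr0. Qed.

Let Psi_free x : Psi x \in free_pred (o := o).
Proof.
move: x; apply: ell1_ind => [|a x y Px Py|v|x Px].
- by rewrite Psi0 rpred0.
- by rewrite PsiD rpredD// rpredZ.
- by rewrite Psi_unit rpredZ// fdelta_subproof.
apply/in_freeP => e e0; have e2 : 0 < e / 2 by rewrite divr_gt0.
have [y /in_freeP/(_ _ e2)[psi psis ype] xye] := Px _ e2.
exists psi => //; rewrite -(subrK (Psi y) (Psi x)) -addrA [e]splitr.
by rewrite (le_lt_trans (ler_normD _ _))// ltrD// -PsiB Psi_norm.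
Qed.

Let Psi_delta (z : M) : exists x, Psi x = delta o z.
Proof.
case: z => [v|].
  exists ((c v)^-1 *: ell1_unit mu0 v + 0).
  by rewrite PsiD Psi_unit scalerA mulVf// scale1r Psi0 addr0.
exists 0; rewrite Psi0.
by apply/val_inj/funext => g /=; rewrite lip0_base.
Qed.

(** Surjectivity onto the free space: the identity holds on combinations of evaluations, all of
    which are values of [Psi], and passes to their closure because [Psi] and [Coord] do not increase
    norms. *)
Let Psi_Coord phi : phi \in free_pred (o := o) -> Psi (Coord phi) = phi.
Proof.
move=> /in_freeP phiP; apply/eqP; rewrite -subr_eq0 -normr_le0.
apply/ler_addgt0Pl => e e0; rewrite addr0.
have e2 : 0 < e / 2 by rewrite divr_gt0.
have [_ [n [a [z ->]]]] := phiP _ e2; set psi := \sum_(i < n) _ => phipsi.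
have [y yE] : exists y, Psi y = psi.
  have /choice[h hE] := Psi_delta; exists (\sum_(i < n) a i *: h (z i)).
  by rewrite /psi; elim/big_rec2: _ => [|i _ y _ <-]; rewrite ?Psi0// PsiD hE.
(* The identity is exact at [psi], so the defect at [phi] is the defect at the small difference
   [phi - psi]. *)
have -> : Psi (Coord phi) - phi = Psi (Coord (phi - psi)) - (phi - psi).
  by rewrite CoordB PsiB -yE Coord_Psi opprB addrA subrK.
rewrite (le_trans (ler_normB _ _))// Psi_norm [e]splitr.
by rewrite lerD// ?(le_trans (Coord_norm_le _))// ltW.
Qed.

Lemma ell1_free_star : exists Phi : {linear ell1 mu0 -> lip_free o},
  [/\ forall x, `|Phi x| = `|x|, forall phi : lip_free o, exists x, Phi x = phi &
      forall v, Phi (ell1_unit mu0 v) = c v *: fdelta o (leaf v)].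
Proof.
pose T x : lip_free o := Free (Psi_free x).
have Tl : linear T by move=> a x y; exact/val_inj/PsiD.
pose Phi : {linear ell1 mu0 -> lip_free o} :=
  HB.pack T (GRing.isLinear.Build _ _ _ _ _ Tl).
exists Phi; split=> [x|phi|v].
- exact: Psi_norm.
- by exists (Coord phi); exact/val_inj/Psi_Coord/free_funP.
- exact/val_inj/Psi_unit.
Qed.

End FreeStar.

(** * Linearity of the shift and its values on unit vectors *)

Section BackwardShift.
Context (R : realType) (V : countType) (E : rel V) (E_tree : directed_tree E).
Context (mu : V -> R) (mu0 : forall v, mu v != 0) (lambda : V -> R).
Context (B : ell1 mu0 -> ell1 mu0) (B_shift : is_backward_shift E lambda B).

Lemma backward_shift_linear : linear B.
Proof.
move=> a x y; apply/val_inj/funext => v /=.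
have [sx xE] := B_shift x v; have [sy yE] := B_shift y v.
have [_ ->] := B_shift (a *: x + y) v.
rewrite -[RHS]/(a * B x v + B y v) xE yE -rsumZ// -rsumD//; last first.
  exact: summable_scale.
congr rsum; apply/funext => u.
by rewrite -[(a *: x + y) u]/(a * x u + y u) mulrDr mulrCA.
Qed.

Lemma backward_shift_unit v w :
  B (ell1_unit mu0 v) w = if v \in chi E w then lambda v else 0.
Proof.
have [_ ->] := B_shift (ell1_unit mu0 v) w.
have [_ <-] := rsum_single (chi E w) v (lambda v); congr rsum.
by apply/funext => u /=; case: eqP => [->|_]; rewrite ?mulr1 ?mulr0.
Qed.

Lemma backward_shift_edge v w : E w v ->
  B (ell1_unit mu0 v) = lambda v *: ell1_unit mu0 w.
Proof.
move=> Ewv; apply/val_inj/funext => u /=; rewrite backward_shift_unit.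
rewrite -[RHS]/(lambda v * if u == w then 1 else 0).
case: eqP => [->|uw]; first by rewrite mem_set ?mulr1.
by rewrite memNset ?mulr0// => /(parent_unique E_tree Ewv)/esym.
Qed.

Lemma backward_shift_root v : is_root E v -> B (ell1_unit mu0 v) = 0.
Proof.
move=> rv; apply/val_inj/funext => u /=; rewrite backward_shift_unit.
by rewrite memNset//; exact/negP/rv.
Qed.

End BackwardShift.

Lemma linear_continuous_bounded (R : realType) (X Y : normedModType R)
    (f : X -> Y) : linear f -> continuous f ->
  exists2 k, 0 < k & forall x, `|f x| <= k * `|x|.
Proof.
move=> fl fc; pose F : {linear X -> Y} :=
  HB.pack f (GRing.isLinear.Build _ _ _ _ _ fl).
by have /linear_bounded_continuous/linear_boundedP/pinfty_ex_gt0 :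
  continuous F := fc.
Qed.

(** * Conjugacy of the shift with the linearization of the parent map on the star *)

Theorem proposition2p8 (R : realType) (V : countType) (E : rel V)
  (E_tree : directed_tree E)
  (mu : V -> R) (mu0 : forall v, mu v != 0)
  (lambda : V -> R) (lambda0 : forall v, ~ is_root E v -> lambda v != 0)
  (B : ell1 mu0 -> ell1 mu0)
  (B_shift : is_backward_shift E lambda B) (B_cont : continuous B) :
  exists (M : metricType R) (o : M) (f : M -> M),
    lip_self o f /\
    exists Phi : {linear ell1 mu0 -> lip_free o},
      [/\ forall x, `|Phi x| = `|x|,
          forall phi, exists x, Phi x = phi &
          forall x, Phi (B x) = linearization f (Phi x)].
Proof.
have [c [c0 cE]] := tree_potential E_tree lambda0.
pose w0 := star_weight_gt0 mu0 c0; pose M := star w0; pose o : M := None.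
pose f (z : M) : M := if z is Some v then parent E v else None.
have Bl := backward_shift_linear B_shift.
have [k k0 Bk] := linear_continuous_bounded Bl B_cont.
have fL : lip_self o f.
  (* The bound [k] of [B] is a Lipschitz constant of [f]: at a unit vector it reads
     [|lambda v * mu w| <= k * |mu v|], and division by [|c v|] turns both sides into branch
     lengths. *)
  apply: (@star_self_lip _ _ _ w0 _ k (ltW k0)) => // v.
  have [rv|[w Ewv]] := parentP E v.
    by rewrite /f parent_None//= mulr_ge0// ltW.
  rewrite /f (parent_Some E_tree Ewv) /=.
  have := Bk (ell1_unit mu0 v); rewrite (backward_shift_edge E_tree B_shift Ewv).
  rewrite normrZ !ell1_norm_unit -normrM => Bv.
  have lv : lambda v != 0 by apply: lambda0 => /(_ w); rewrite Ewv.
  have -> : mu w / c w = lambda v * mu w / c v.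
    by rewrite (cE _ _ Ewv) invfM mulrACA divff// mul1r.
  by rewrite !normrM -normrM mulrA ler_wpM2r.
have [Phi [Phi_norm Phi_surj Phi_unit]] := ell1_free_star mu0 c0.
exists M, o, f; split=> //; exists Phi; split=> //.
have [Tl Tc Td] := linearizationP fL.
move: (linearization f) Tl Tc Td => T Tl Tc Td.
pose F : {linear lip_free o -> lip_free o} :=
  HB.pack T (GRing.isLinear.Build _ _ _ _ _ Tl).
pose G : {linear ell1 mu0 -> ell1 mu0} :=
  HB.pack B (GRing.isLinear.Build _ _ _ _ _ Bl).
have [r r0 Tr] := linear_continuous_bounded Tl Tc.
suff H x : Phi (G x) = F (Phi x) by [].
move: x; apply: ell1_ind => [|a x y Hx Hy|v|x Hx].
- by rewrite !linear0.
- by rewrite !linearP Hx Hy.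
- rewrite Phi_unit linearZ /= Td.
  have [rv|[w Ewv]] := parentP E v.
    (* [B] kills the unit vector of a root; correspondingly [f] sends that leaf to the centre, where
       the evaluation is zero. *)
    rewrite (backward_shift_root B_shift rv) linear0 /f parent_None//.
    rewrite (_ : fdelta o _ = 0) ?scaler0//.
    by apply/val_inj/val_inj/funext => g /=; rewrite lip0_base.
  rewrite (backward_shift_edge E_tree B_shift Ewv) linearZ /= Phi_unit /f.
  by rewrite (parent_Some E_tree Ewv) scalerA -(cE _ _ Ewv).
apply/eqP; rewrite -subr_eq0 -normr_le0; apply/ler_addgt0Pl => e e0.
rewrite addr0; have kr : 0 < k + r by rewrite addr_gt0.
have [y Hy xy] := Hx _ (divr_gt0 e0 kr).
(* The defect vanishes at [y], so it only sees [x - y] and is at most [k + r] times its norm; hence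
   the tolerance [e / (k + r)]. *)
have -> : Phi (G x) - F (Phi x) = Phi (G (x - y)) - F (Phi (x - y)).
  have GB : G (x - y) = G x - G y by exact: raddfB.
  have PB a b : Phi (a - b) = Phi a - Phi b by exact: raddfB.
  have FB a b : F (a - b) = F a - F b by exact: raddfB.
  by rewrite GB !PB FB Hy opprB addrA subrK.
rewrite (le_trans (ler_normB _ _))// Phi_norm.
rewrite (le_trans (lerD (Bk _) (Tr _)))// Phi_norm -mulrDl mulrC.
by rewrite -ler_pdivlMr// ltW.
Qed.
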